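(* Let $q\ge 2$, $n\ge 2$ and $1\le k\le n-1$ be integers. Then $$S_1^k(q,n)\ \ge\ \left(q-\left\lfloor\frac{k}{k+1}\cdot q\right\rfloor\right)\left\lfloor\frac{k}{k+1}\cdot q\right\rfloor^{k}q^{\,n-k-1}.$$
   Context: Let $\Sigma$ be a finite alphabet with $q\ge 2$ letters. Two (not necessarily distinct) words $u,v$ over $\Sigma$ have a $t$-overlap if the prefix of $u$ of length $t$ equals the suffix of $v$ of length $t$, or vice versa. A code $C\subseteq\Sigma^n$ ($n\ge 2$) is $(1,k)$-overlap-free if for all $1\le t\le k$ no two (not necessarily distinct) codewords in $C$ have a $t$-overlap. $S_1^k(q,n)$ denotes the maximum size of a $(1,k)$-overlap-free code $C\subseteq\Sigma^n$ with $|\Sigma|=q$. *)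

(* Defs.v *)
From mathcomp Require Import all_boot.

Set Implicit Arguments.
Unset Strict Implicit.
Unset Printing Implicit Defensive.

(* [w] is the common prefix/suffix; as it has exactly [t] letters, words of
   length less than [t] have no t-overlap. *)
Definition has_overlap (Sigma : finType) (t : nat) (u v : seq Sigma) : bool :=
  [exists w : t.-tuple Sigma,
     (prefix w u && suffix w v) || (prefix w v && suffix w u)].

(* (1,k)-overlap-freeness; [u] and [v] may be the same codeword. *)
Definition overlap_free (Sigma : finType) (k n : nat)
    (C : {set n.-tuple Sigma}) : bool :=
  [forall t : 'I_k.+1, (1 <= t) ==>
     [forall u in C, forall v in C, ~~ has_overlap t u v]].

(* S_1^k(q, n) for an alphabet [Sigma] with q letters; the empty code is
   overlap-free, so this is a maximum over a nonempty family. *)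
Definition S1 (Sigma : finType) (k n : nat) : nat :=
  \max_(C : {set n.-tuple Sigma} | overlap_free k C) #|C|.

(* Main.v *)
Require Import Defs.
From mathcomp Require Import all_boot.
From mathcomp Require Import zify.

Set Implicit Arguments.
Unset Strict Implicit.
Unset Printing Implicit Defensive.

(** Fix a set [A] of [floor (k q / (k + 1))] letters and take all words whose
    first letter lies outside [A] and whose last [k] letters lie in [A].  For
    [1 <= t <= k], a prefix of length [t] of such a word starts outside [A],
    while a suffix of length [t] lies entirely in [A]. *)

(** Tabulation [h] is a bijection from the finite functions in [family F] onto these tuples, so
    [card_family] does the counting. *)
Lemma card_tuple_family (T : finType) (n : nat) (F : 'I_n -> {set T}) :
  #|[set u : n.-tuple T | [forall i, tnth u i \in F i]]| = \prod_(i < n) #|F i|.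
Proof.
pose h (f : {ffun 'I_n -> T}) : n.-tuple T := [tuple f i | i < n].
have h_inj : injective h.
  move=> f g eq_hfg; apply/ffunP => i.
  by have := congr1 (fun u => tnth u i) eq_hfg; rewrite !tnth_mktuple.
have -> : [set u : n.-tuple T | [forall i, tnth u i \in F i]]
          = h @: [set f in family F].
  apply/setP => u; rewrite inE; apply/forallP/imsetP => [Fu | [f]].
    exists [ffun i => tnth u i].
      by rewrite inE; apply/familyP => i; rewrite ffunE.
    by apply: eq_from_tnth => i; rewrite tnth_mktuple ffunE.
  by rewrite inE => /familyP Ff -> i; rewrite tnth_mktuple.
rewrite card_imset // cardsE card_family foldrE big_map big_enum.
exact: eq_bigr.
Qed.

Lemma exists_set_card (T : finType) (m : nat) :
  m <= #|T| -> exists A : {set T}, #|A| = m.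
Proof.
move=> le_mT; exists [set x in take m (enum T)].
rewrite cardsE (card_uniqP _) ?take_uniq ?enum_uniq // size_takel //.
by rewrite -cardE.
Qed.

(** Constraining each position separately makes the code a product of sets. For [k < n] the first
    two cases never compete, since [n - k > 0]. *)
Definition border_slot (T : finType) (A : {set T}) (k n i : nat) : {set T} :=
  if i == 0 then ~: A else if n - k <= i then A else setT.

Definition border_code (T : finType) (A : {set T}) (k n : nat) :
    {set n.-tuple T} :=
  [set u : n.-tuple T | [forall i, tnth u i \in border_slot A k n i]].

Lemma border_codeP (T : finType) (A : {set T}) (k n : nat) (u : n.-tuple T)
    (x0 : T) (i : nat) :
  u \in border_code A k n -> i < n -> nth x0 u i \in border_slot A k n i.
Proof.
rewrite inE => /forallP Cu lt_in.
by have := Cu (Ordinal lt_in); rewrite (tnth_nth x0).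
Qed.

Lemma card_border_code (T : finType) (A : {set T}) (k n : nat) :
  k < n ->
  #|border_code A k n| = (#|T| - #|A|) * #|A| ^ k * #|T| ^ (n - k - 1).
Proof.
move=> lt_kn; rewrite card_tuple_family.
rewrite -(big_mkord xpredT (fun i => #|border_slot A k n i|)).
(* Split the positions into [0], the [n - k - 1] free ones, and the last [k]. *)
rewrite big_ltn ?(leq_ltn_trans _ lt_kn) // (@big_cat_nat _ _ _ (n - k)) /=; try lia.
rewrite {1}/border_slot /= cardsCs setCK.
rewrite (eq_big_nat _ _ (F2 := fun=> #|T|)); last first.
  by move=> i /andP[i_gt0 i_lt]; rewrite /border_slot -cardsT ifN ?ifN //; lia.
rewrite [X in _ * (_ * X)](eq_big_nat _ _ (F2 := fun=> #|A|)); last first.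
  by move=> i /andP[i_ge i_lt]; rewrite /border_slot ifN ?i_ge //; lia.
rewrite !prod_nat_const_nat subKn 1?ltnW //.
by rewrite (mulnC (_ ^ _) (_ ^ k)) mulnA.
Qed.

Lemma border_code_prefix_suffix (T : finType) (A : {set T}) (k n : nat)
    (u v : n.-tuple T) (w : seq T) :
  k < n -> 0 < size w <= k -> u \in border_code A k n ->
  v \in border_code A k n -> prefix w u -> suffix w v -> False.
Proof.
(* The head [x] of the overlap yields the contradiction, and also serves as the default value for
   [nth]. *)
move=> lt_kn; case: w => // x w /= le_wk Cu Cv.
case/prefixP => u' def_u /suffixP[v' def_v].
have size_v : size v' + (size w).+1 = n.
  by rewrite -[RHS](size_tuple v) def_v size_cat.
have := border_codeP x Cu (leq_ltn_trans (leq0n k) lt_kn).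
rewrite def_u /border_slot /= inE => xA'.
(* In [v] the letter [x] sits at position [size v']. An overlap of length at most [k < n] cannot
   reach back to position [0], so the slot there is [A]. *)
have [lt_v'n v'_neq0 v'_ge] : [/\ size v' < n, size v' != 0 & n - k <= size v'] by split; lia.
have := border_codeP x Cv lt_v'n.
rewrite def_v nth_cat ltnn subnn /border_slot /= (negPf v'_neq0) v'_ge.
by rewrite (negPf xA').
Qed.

Lemma border_code_overlap_free (T : finType) (A : {set T}) (k n : nat) :
  k < n -> overlap_free k (border_code A k n).
Proof.
move=> lt_kn; apply/forallP => t; apply/implyP => t_gt0.
apply/forall_inP => u Cu; apply/forall_inP => v Cv.
have size_w (w : t.-tuple T) : 0 < size w <= k.
  by rewrite size_tuple t_gt0 -ltnS ltn_ord.
apply/existsP => -[w /orP[]] /andP[].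
  exact: border_code_prefix_suffix (size_w w) Cu Cv.
exact: border_code_prefix_suffix (size_w w) Cv Cu.
Qed.

Theorem proposition9 (q n k : nat) (Sigma : finType)
    (hSigma : #|Sigma| = q) (hq : 2 <= q) (hn : 2 <= n)
    (hk1 : 1 <= k) (hkn : k <= n - 1) :
  S1 Sigma k n >=
    (q - (k * q) %/ (k + 1)) * ((k * q) %/ (k + 1)) ^ k * q ^ (n - k - 1).
Proof.
have lt_kn : k < n by lia.
have le_mq : (k * q) %/ (k + 1) <= #|Sigma|.
  by rewrite hSigma -ltnS ltn_divLR; nia.
have [A cardA] := exists_set_card le_mq.
rewrite -cardA -hSigma -card_border_code //.
exact: leq_bigmax_cond (border_code_overlap_free A lt_kn).
Qed.
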